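(* For all $n\ge3$, we have $c_n(132,213,231,312)=2$.
   Context: A word $\pi=\pi_1\dots\pi_m$ over the positive integers contains the pattern $\sigma=\sigma_1\dots\sigma_k$ if there are indices $1\le i_1<\dots<i_k\le m$ such that for all $r,s\in\{1,\dots,k\}$: $\pi_{i_r}<\pi_{i_s}$ iff $\sigma_r<\sigma_s$, and $\pi_{i_r}=\pi_{i_s}$ iff $\sigma_r=\sigma_s$; otherwise $\pi$ avoids $\sigma$. $\mathcal{C}_n$ denotes the set of nonnesting permutations: arrangements (words) of the multiset $\{1,1,2,2,\dots,n,n\}$ that avoid the patterns $1221$ and $2112$. For patterns $\sigma,\tau,\dots$, $c_n(\sigma,\tau,\dots)$ is the number of $\pi\in\mathcal{C}_n$ avoiding all of $\sigma,\tau,\dots$. *)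

(* Defs.v *)
From mathcomp Require Import all_boot.

Set Implicit Arguments.
Unset Strict Implicit.
Unset Printing Implicit Defensive.

(* Positions are 0-based; [i] is the choice i_1 < ... < i_k of positions of w. *)
Definition contains (w s : seq nat) : bool :=
  [exists i : {ffun 'I_(size s) -> 'I_(size w)},
    [forall r : 'I_(size s), forall t : 'I_(size s),
      [&& (r < t) ==> (i r < i t),
          (nth 0 w (i r) < nth 0 w (i t)) == (nth 0 s r < nth 0 s t)
        & (nth 0 w (i r) == nth 0 w (i t)) == (nth 0 s r == nth 0 s t)]]].

Definition avoids (w s : seq nat) : bool := ~~ contains w s.

(* [permutations] is duplicate-free, also when its argument has repeated
   letters, so [nonnesting n] lists every nonnesting permutation once. *)
Definition nonnesting (n : nat) : seq (seq nat) :=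
  [seq w <- permutations (iota 1 n ++ iota 1 n) |
    avoids w [:: 1; 2; 2; 1] && avoids w [:: 2; 1; 1; 2]].

Definition c (n : nat) (patterns : seq (seq nat)) : nat :=
  size [seq w <- nonnesting n | all (avoids w) patterns].

(* Main.v *)
Require Import Defs.
From mathcomp Require Import all_boot.
From mathcomp Require Import zify.

(** A word avoids 132, 213, 231 and 312 exactly when any three positions that
    carry distinct letters read an increasing or a decreasing triple.  Call a
    pair of positions with distinct letters ascending or descending according
    to the order in which its letters appear.  In a monotone triple all three
    pairs are of the same kind, so a pair keeps its kind when one of its
    positions is moved to a position carrying a third letter
    ([ascending_exchange]).  As soon as the word has three distinct letters,
    such moves lead from any pair to any other ([ascending_constant]), hence
    all pairs are of the same kind and the word is weakly increasing or weakly
    decreasing ([monotone_word]).  Conversely, a pattern contained in a weakly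
    monotone word is weakly monotone in the same direction
    ([contains_sorted]), and none of the four patterns, nor 1221 or 2112, is
    monotone.  The two words counted are therefore 1122...nn and its reversal,
    each the only monotone arrangement of the multiset in its direction. *)

Section Monotone.

Variable w : seq nat.

Let lw i := nth 0 w i.

(** Only meant for positions with distinct letters; then it is symmetric in
    the two positions. *)
Definition ascending (i j : nat) : bool := (i < j) == (lw i < lw j).

Lemma ascendingC i j : lw i != lw j -> ascending i j = ascending j i.
Proof.
move=> neq; have neij : i != j by apply: contraNneq neq => ->.
rewrite /ascending; case: (ltngtP i j) neij neq => //= _ _;
  by case: ltngtP.
Qed.

Lemma contains3 x y z i j k :
    i < j -> j < k -> k < size w ->
    [/\ (lw i < lw j) = (x < y), (lw j < lw k) = (y < z)
      & (lw i < lw k) = (x < z)] ->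
    [/\ (lw j < lw i) = (y < x), (lw k < lw j) = (z < y)
      & (lw k < lw i) = (z < x)] ->
  contains w [:: x; y; z].
Proof.
move=> ij jk kw [xy yz xz] [yx zy zx].
have jw := ltn_trans jk kw; have iw := ltn_trans ij jw.
have ik := ltn_trans ij jk.
apply/existsP.
exists [ffun r : 'I_3 =>
  nth (Ordinal iw) [:: Ordinal iw; Ordinal jw; Ordinal kw] r].
(* Equality of letters is determined by the two strict comparisons. *)
have eqE (a b c d : nat) : (a < b) = (c < d) -> (b < a) = (d < c) ->
  (a == b) == (c == d) by lia.
apply/forallP => r; apply/forallP => t; rewrite !ffunE.
by case: r => [[|[|[|//]]] /= _]; case: t => [[|[|[|//]]] /= _];
  rewrite ?ij ?jk ?ik ?xy ?yz ?xz ?yx ?zy ?zx ?ltnn ?eqxx //=; exact: eqE.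
Qed.

(** A triple of distinct letters that is not monotone has a peak or a valley in
    the middle; comparing the outer letters, a peak is 132 or 231 and a valley
    is 213 or 312. *)
Lemma triple_monotone i j k :
    avoids w [:: 1; 3; 2] -> avoids w [:: 2; 1; 3] ->
    avoids w [:: 2; 3; 1] -> avoids w [:: 3; 1; 2] ->
    i < j -> j < k -> k < size w ->
    lw i != lw j -> lw j != lw k -> lw i != lw k ->
  (lw i < lw j) = (lw j < lw k).
Proof.
move=> a132 a213 a231 a312 ij jk kw nij njk nik.
case: (ltngtP (lw i) (lw j)) nij => // hij _;
case: (ltngtP (lw j) (lw k)) njk => // hjk _;
case: (ltngtP (lw i) (lw k)) nik => // hik _.
- by case/negP: a132; apply: (contains3 _ _ _ i j k) => //; split; lia.
- by case/negP: a231; apply: (contains3 _ _ _ i j k) => //; split; lia.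
- by case/negP: a213; apply: (contains3 _ _ _ i j k) => //; split; lia.
- by case/negP: a312; apply: (contains3 _ _ _ i j k) => //; split; lia.
Qed.

Hypothesis triple : forall i j k, i < j -> j < k -> k < size w ->
  lw i != lw j -> lw j != lw k -> lw i != lw k ->
  (lw i < lw j) = (lw j < lw k).

(** The pairs [(i, j)] and [(i, k)] are two of the three pairs of a monotone
    triple, whichever way [i], [j], [k] are ordered. *)
Lemma ascending_exchange i j k :
    i < size w -> j < size w -> k < size w ->
    lw i != lw j -> lw i != lw k -> lw j != lw k ->
  ascending i j = ascending i k.
Proof.
move=> iw jw kw nij nik njk; rewrite /ascending.
have dij : i != j by apply: contraNneq nij => ->.
have dik : i != k by apply: contraNneq nik => ->.
have djk : j != k by apply: contraNneq njk => ->.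
have T1 := triple i j k; have T2 := triple i k j; have T3 := triple j i k.
have T4 := triple j k i; have T5 := triple k i j; have T6 := triple k j i.
case: (ltngtP i j) dij T1 T2 T3 T4 T5 T6 => // hij _;
case: (ltngtP i k) dik => // hik _;
case: (ltngtP j k) djk => // hjk _; lia.
Qed.

Hypothesis third_letter :
  forall a b, exists2 c, c \in w & (c != a) && (c != b).

(** Exchanges move one pair of positions to any other.  If the second pair has
    a letter that the first lacks, that letter serves as the third one;
    otherwise both pairs carry the same two letters, and the path goes through
    a further letter of the word. *)
Lemma ascending_constant i j k l :
    i < size w -> j < size w -> k < size w -> l < size w ->
    lw i != lw j -> lw k != lw l ->
  ascending i j = ascending k l.
Proof.
move=> iw jw kw lw' nij nkl.
(* The path goes through [p]: [(i, j)], [(i, p)], [(q, p)], except that it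
     leaves [i] first when [q] repeats the letter of [i]. *)
have new p q : p < size w -> q < size w -> lw p != lw q ->
    lw p != lw i -> lw p != lw j -> ascending i j = ascending p q.
  move=> pw qw npq npi npj.
  have [eqi|neqi] := eqVneq (lw q) (lw i).
    rewrite (ascendingC i j) // (ascending_exchange j i p) //; try lia.
    by rewrite (ascendingC j p) ?(ascending_exchange p j q) //; lia.
  rewrite (ascending_exchange i j p) //; try lia.
  by rewrite (ascendingC i p) ?(ascending_exchange p i q) //; lia.
(* Here the path is [(i, j)], [(i, m)], [(q, m)], [(q, p)], with [m] carrying
     a letter outside the pair. *)
have same p q : p < size w -> q < size w ->
    lw p = lw i -> lw q = lw j -> ascending i j = ascending p q.
  move=> pw qw ep eq.
  have [c /(nthP 0) [m mw em] /andP[nci ncj]] := third_letter (lw i) (lw j).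
  have lm : lw m = c by [].
  rewrite (ascending_exchange i j m) //; try lia.
  rewrite (ascendingC i m) ?(ascending_exchange m i q) //; try lia.
  by rewrite (ascendingC m q) ?(ascending_exchange q m p)
             ?(ascendingC q p) //; lia.
have [ki|nki] := eqVneq (lw k) (lw i); have [kj|nkj] := eqVneq (lw k) (lw j);
have [li|nli] := eqVneq (lw l) (lw i); have [lj|nlj] := eqVneq (lw l) (lw j);
  first [ by lia
        | by apply: new
        | by apply: same
        | by rewrite (ascendingC k l) //; apply: new; rewrite // eq_sym
        | by rewrite (ascendingC k l) //; apply: same ].
Qed.

Lemma monotone_word : sorted leq w || sorted geq w.
Proof.
case: (boolP (sorted leq w)) => //= /(sortedP 0) nsorted.
apply/(sortedP 0) => i iw; rewrite /= leqNgt; apply/negP => asc_i.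
case: nsorted => j jw; rewrite leqNgt; apply/negP => desc_j.
have := @ascending_constant i i.+1 j j.+1 (ltnW iw) iw (ltnW jw) jw.
rewrite /ascending /lw !ltnSn; lia.
Qed.

End Monotone.

(** An occurrence preserves the order of positions and reflects strict
    inequalities of letters, so a strict descent of the pattern would be one of
    the word, and likewise for ascents. *)
Lemma contains_sorted (r : rel nat) w s :
    transitive r -> (r = leq \/ r = geq) ->
  contains w s -> sorted r w -> sorted r s.
Proof.
move=> r_tr rE /existsP[f /forallP Hf] w_sorted.
apply/(sortedP 0) => i si.
have /forallP/(_ (Ordinal si))/and3P[/= lt_f /eqP lt_w /eqP eq_w] :=
  Hf (Ordinal (ltnW si)).
move: lt_f; rewrite ltnSn /= => lt_f.
move: w_sorted; rewrite sorted_pairwise // => /(pairwiseP 0) w_pw.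
have := w_pw _ _ (ltn_ord _) (ltn_ord _) lt_f.
by case: rE => ->; rewrite /= => ?; lia.
Qed.

Lemma monotone_avoids w s :
    sorted leq w || sorted geq w -> ~~ sorted leq s -> ~~ sorted geq s ->
  avoids w s.
Proof.
move=> w_mono nle nge; apply/negP => ws.
case/orP: w_mono => sw.
  by case/negP: nle; apply: contains_sorted ws sw; [exact: leq_trans | left].
case/negP: nge; apply: contains_sorted ws sw; last by right.
by move=> a b d /= ba ad; apply: leq_trans ad ba.
Qed.

Theorem theorem2p18 (n : nat) (hn : 3 <= n) :
  c n [:: [:: 1; 3; 2]; [:: 2; 1; 3]; [:: 2; 3; 1]; [:: 3; 1; 2]] = 2.
Proof.
rewrite /c /nonnesting; set m := iota 1 n ++ iota 1 n.
have geq_tr : transitive geq by move=> a b d /= ba ad; apply: leq_trans ad ba.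
have geq_anti : antisymmetric geq by move=> a b /=; lia.
have geq_total : total geq by move=> a b /=; lia.
have mem_m x : (x \in m) = (0 < x <= n).
  by rewrite mem_cat orbb mem_iota add1n ltnS.
set up := sort leq m; set down := sort geq m.
have up_sorted : sorted leq up := sort_sorted leq_total m.
have down_sorted : sorted geq down := sort_sorted geq_total m.
(* A word sorted both ways is constant, but [m] has the letters 1 and 2. *)
have up_down : up != down.
  apply/eqP => E; move: down_sorted; rewrite -E.
  move: up_sorted; rewrite !sorted_pairwise //; last exact: leq_trans.
  move=> /(pairwiseP 0) le_up /(pairwiseP 0) ge_up.
  have [|i iu i1] := nthP 0 (_ : 1 \in up); first by rewrite mem_sort mem_m; lia.
  have [|j ju j2] := nthP 0 (_ : 2 \in up); first by rewrite mem_sort mem_m; lia.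
  case: (ltngtP i j) => [ij|ji|ij]; last by move: i1; rewrite ij j2.
    by have := ge_up _ _ iu ju ij; rewrite /= i1 j2.
  by have := le_up _ _ ju iu ji; rewrite i1 j2.
rewrite -[RHS]/(size [:: up; down]); apply: perm_size; apply: uniq_perm.
- by rewrite !filter_uniq // permutations_uniq.
- by rewrite /= inE up_down.
move=> w; rewrite !mem_filter mem_permutations !inE; apply/idP/idP.
  case/andP=> /= /and5P[a132 a213 a231 a312 _] /andP[_ w_m].
  have third a b : exists2 d, d \in w & (d != a) && (d != b).
    have [d d123 dab] : exists2 d, 0 < d <= 3 & (d != a) && (d != b).
      case: (boolP ((1 != a) && (1 != b))) => [|H1]; first by exists 1.
      case: (boolP ((2 != a) && (2 != b))) => [|H2]; first by exists 2.
      by exists 3; lia.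
    by exists d; rewrite // (perm_mem w_m) mem_m; lia.
  have tri i j k := triple_monotone w i j k a132 a213 a231 a312.
  case/orP: (monotone_word w tri third) => sw; apply/orP; [left|right];
    apply/eqP.
    apply: (sorted_eq leq_trans anti_leq sw up_sorted).
    by rewrite perm_sym perm_sort perm_sym.
  apply: (sorted_eq geq_tr geq_anti sw down_sorted).
  by rewrite perm_sym perm_sort perm_sym.
move=> w_ud.
have w_mono : sorted leq w || sorted geq w.
  by case/orP: w_ud => /eqP->; rewrite ?up_sorted ?down_sorted ?orbT.
have w_m : perm_eq w m by case/orP: w_ud => /eqP->; rewrite perm_sort.
by rewrite /= w_m !(monotone_avoids w).
Qed.
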